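(* Let $(a,b)\times R\subseteq\mathbb{R}^{d+1}=\mathbb{R}\times\mathbb{R}^d$ be a (possibly unbounded) rectangle, $R=\prod_{k=1}^d(a_k,b_k)$. Let $f(x,\mathbf{y})$ be quasicontinuous and nonnegative on $(a,b)\times R$ and suppose that $\mathbf{y}\mapsto f(x,\mathbf{y})$ is summable on $R$ for a.e. $x\in(a,b)$. If the function $$x\mapsto\int_R f(x,\mathbf{y})\,d\mathbf{y}$$ is summable on $(a,b)$, then $(x,\mathbf{y})\mapsto f(x,\mathbf{y})$ is summable on $(a,b)\times R$ (and so the reduction formula $$\int_{(a,b)\times R}f(x,\mathbf{y})\,d(x,\mathbf{y})=\int_a^b\Big[\int_R f(x,\mathbf{y})\,d\mathbf{y}\Big]dx$$ holds). All integrals are Lebesgue integrals in the sense of Tonelli (defined in the context).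
   Context: The following definitions are used in $\mathbb{R}^n$ for every $n\ge1$. A rectangle is a product of $n$ intervals of the real line; $L$ of a rectangle is the product of the lengths of its sides. A multirectangle $\Delta=\{R_j\}$ is a finite or countable sequence of rectangles (not necessarily disjoint, no topological condition); $\mathcal{I}_\Delta=\bigcup_jR_j$ and $L(\Delta)=\sum_jL(R_j)$. A set $N$ is a null set if for every $\varepsilon>0$ there is a multirectangle $\Delta$ with $L(\Delta)<\varepsilon$, $N\subseteq\mathcal{I}_\Delta$; a.e. means outside a null set. For $0<\rho\le+\infty$ put $D_\rho=\{x\in\mathbb{R}^n:\|x\|\le\rho\}$ ($D_{+\infty}=\mathbb{R}^n$). A real function $f$ a.e. defined on $D_\rho$ is quasicontinuous if for every $\varepsilon>0$ there is a multirectangle $\Delta$ with $L(\Delta)<\varepsilon$ and $\mathcal{I}_\Delta$ open such that $f$ is defined and its restriction is continuous on $D_\rho\setminus\mathcal{I}_\Delta$. Lebesgue integral (Tonelli), bounded case: if $f$ is bounded quasicontinuous on $D_\rho$, $\rho<+\infty$, choose $\varepsilon_j\to0^+$, multirectangles $\Delta_j$ with $L(\Delta_j)<\varepsilon_j$, $\mathcal{I}_{\Delta_j}$ open, $f_{|D_\rho\setminus\mathcal{I}_{\Delta_j}}$ continuous, and continuous extensions $f_j$ of $f_{|D_\rho\setminus\mathcal{I}_{\Delta_j}}$ to $\mathbb{R}^n$ with the same infimum and supremum. Then $\int_{D_\rho}f:=\lim_j\int_{D_\rho}f_j$ (Riemann integrals on the right; the limit exists and is independent of the choices). General case: for $f$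 quasicontinuous on $\mathbb{R}^n$ put $f_+=\max\{f,0\}$, $f_-=\min\{f,0\}$, $\int_{\mathbb{R}^n}f_+:=\lim_{\rho,N\to+\infty}\int_{D_\rho}\min\{f_+,N\}$, $\int_{\mathbb{R}^n}f_-:=\lim_{\rho,K\to+\infty}\int_{D_\rho}\max\{f_-,-K\}$. The function $f$ is integrable if at least one of these is finite, and then $\int_{\mathbb{R}^n}f:=\int f_++\int f_-$; it is summable if this is finite. For a set $A$ whose characteristic function is quasicontinuous, $f$ (a.e. defined on $A$) is quasicontinuous, integrable or summable on $A$ if its extension by $0$ outside $A$ is quasicontinuous, integrable or summable on $\mathbb{R}^n$, and $\int_Af$ is the integral over $\mathbb{R}^n$ of that extension. *)

(* Defs.v *)
From mathcomp Require Import all_boot all_order all_algebra.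
From mathcomp Require Import all_classical all_reals all_analysis.

Set Implicit Arguments.
Unset Strict Implicit.
Unset Printing Implicit Defensive.

Import Order.TTheory GRing.Theory Num.Theory.
Import numFieldNormedType.Exports.

Local Open Scope classical_set_scope.
Local Open Scope ring_scope.

(* Points of R^n are row vectors.  A real function that need not be defined
   everywhere is an option-valued function, [None] meaning "undefined". *)

Section Tonelli.
Variables (R : realType) (n : nat).
Implicit Types (f : 'rV[R]_n -> option R) (A : set 'rV[R]_n).

Definition rectangle := 'I_n -> interval R.

Definition rect_set (I : rectangle) : set 'rV[R]_n :=
  [set x | forall k, x 0 k \in I k].

(* [wlength idfun] is the length of an interval: 0 if it is empty or a point,
   +oo if it is unbounded.  A degenerate side gives L = 0, as 0 * +oo = 0. *)
Definition rect_L (I : rectangle) : \bar R :=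
  (\prod_(k < n) wlength idfun [set` I k])%E.

(* Since n >= 1, empty rectangles have L = 0, so a finite multirectangle is a
   sequence padded with empty rectangles. *)
Definition multirectangle := nat -> rectangle.

Definition mrect_set (D : multirectangle) : set 'rV[R]_n :=
  \bigcup_j rect_set (D j).

Definition mrect_L (D : multirectangle) : \bar R :=
  (\sum_(0 <= j <oo) rect_L (D j))%E.

Definition tonelli_null A := forall eps : R, 0 < eps ->
  exists D : multirectangle, (mrect_L D < eps%:E)%E /\ A `<=` mrect_set D.

(* The library norm of 'rV[R]_n is the maximum norm. *)
Definition eucl_norm (x : 'rV[R]_n) : R := Num.sqrt (\sum_(k < n) x 0 k ^+ 2).

Definition disk (rho : \bar R) : set 'rV[R]_n :=
  [set x | ((eucl_norm x)%:E <= rho)%E].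

Definition continuous_off (rho : \bar R) f (eps : R) (D : multirectangle) :=
  [/\ (mrect_L D < eps%:E)%E,
      open (mrect_set D),
      (disk rho `\` mrect_set D) `<=` [set x | f x]
    & {within disk rho `\` mrect_set D, continuous (odflt 0 \o f)}].

(* This forces the set where f is undefined to be null in [disk rho]. *)
Definition quasicontinuous (rho : \bar R) f := forall eps : R, 0 < eps ->
  exists D : multirectangle, continuous_off rho f eps D.

(* Riemann integral over the box with opposite corners lo and hi.  Points of
   subdivision may be repeated, so all axes can share the same number m of
   steps; c ranges over the m ^ n cells and t picks a tag in each. *)
Definition tagged_grid (lo hi : 'rV[R]_n) (delta : R) (m : nat)
    (p : 'I_n -> nat -> R) (t : {ffun 'I_n -> 'I_m} -> 'rV[R]_n) :=
  [/\ forall k, p k 0%N = lo 0 k,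
      forall k, p k m = hi 0 k,
      forall k j, (j < m)%N -> p k j <= p k j.+1 < p k j + delta
    & forall (c : {ffun 'I_n -> 'I_m}) k, p k (c k) <= t c 0 k <= p k (c k).+1].

Definition riemann_sum (h : 'rV[R]_n -> R) (m : nat)
    (p : 'I_n -> nat -> R) (t : {ffun 'I_n -> 'I_m} -> 'rV[R]_n) : R :=
  \sum_(c : {ffun 'I_n -> 'I_m})
    h (t c) * \prod_(k < n) (p k (c k).+1 - p k (c k)).

Definition has_riemann_integral (lo hi : 'rV[R]_n) (h : 'rV[R]_n -> R)
    (v : R) :=
  forall eps : R, 0 < eps -> exists2 delta : R, 0 < delta &
    forall m p (t : {ffun 'I_n -> 'I_m} -> 'rV[R]_n),
      tagged_grid lo hi delta p t -> `|riemann_sum h p t - v| < eps.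

(* The disk is contained in the cube [-r, r]^n. *)
Definition riemann_integral (r : R) (g : 'rV[R]_n -> R) : R :=
  get (has_riemann_integral (const_mx (- r)) (const_mx r)
         (fun x => \1_(disk r%:E) x * g x)).

(* As g j agrees with f on S, the last two clauses say that g j has the infimum
   and supremum of f on S.  In \bar R, unlike in R, inf and sup are meaningful
   on unbounded and empty sets; in particular S must be nonempty. *)
Definition tonelli_approx (r : R) f (e : nat -> R)
    (D : nat -> multirectangle) (g : nat -> 'rV[R]_n -> R) :=
  (forall j, 0 < e j) /\ e @ \oo --> (0 : R) /\
  forall j, let S := disk r%:E `\` mrect_set (D j) in
    [/\ continuous_off r%:E f (e j) (D j),
        continuous (g j),
        forall x, S x -> f x = Some (g j x),
        ereal_inf (range (EFin \o g j)) = ereal_inf ((EFin \o g j) @` S)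
      & ereal_sup (range (EFin \o g j)) = ereal_sup ((EFin \o g j) @` S)].

(* Meant for f bounded and quasicontinuous on the disk of radius r; the value
   is the limit along some choice of approximations. *)
Definition bounded_integral (r : R) f : R :=
  get [set v | exists e D g, tonelli_approx r f e D g /\
                 (fun j => riemann_integral r (g j)) @ \oo --> v].

Definition tonelli_pos f : \bar R :=
  lim ((fun q : R * R =>
          (bounded_integral q.1
             (omap (fun v => Num.min (Num.max v 0) q.2) \o f))%:E)
       @ filter_prod (pinfty_nbhs R) (pinfty_nbhs R)).

(* Here the negative part is min(f, 0), hence nonpositive. *)
Definition tonelli_neg f : \bar R :=
  lim ((fun q : R * R =>
          (bounded_integral q.1
             (omap (fun v => Num.max (Num.min v 0) (- q.2)) \o f))%:E)
       @ filter_prod (pinfty_nbhs R) (pinfty_nbhs R)).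

Definition tonelli_integral f : \bar R := (tonelli_pos f + tonelli_neg f)%E.

Definition tonelli_integrable f := quasicontinuous +oo%E f /\
  (tonelli_pos f \is a fin_num \/ tonelli_neg f \is a fin_num).

Definition tonelli_summable f := tonelli_integrable f /\ tonelli_integral f \is a fin_num.

(* The notions on a set A are meant for A with quasicontinuous characteristic
   function, for instance a rectangle. *)
Definition extend0 A f : 'rV[R]_n -> option R :=
  fun x => if x \in A then f x else Some 0.

Definition quasicontinuous_on A f := quasicontinuous +oo%E (extend0 A f).

Definition summable_on A f := tonelli_summable (extend0 A f).

Definition integral_on A f : \bar R := tonelli_integral (extend0 A f).

(* Product of open intervals, with possibly infinite endpoints. *)
Definition open_rect (a b : 'I_n -> \bar R) : set 'rV[R]_n :=
  [set x | forall k, (a k < (x 0 k)%:E < b k)%E].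

End Tonelli.

Section Product.
Variables (R : realType) (d : nat).

Definition open_itv1 (a b : \bar R) : set 'rV[R]_1 :=
  open_rect (fun=> a) (fun=> b).

Definition prod_set (A : set 'rV[R]_1) (B : set 'rV[R]_d)
    : set 'rV[R]_(1 + d) :=
  [set z | A (lsubmx z) /\ B (rsubmx z)].

Definition section_at (f : 'rV[R]_(1 + d) -> option R) (x : 'rV[R]_1)
    : 'rV[R]_d -> option R :=
  fun y => f (row_mx x y).

(* Defined exactly at those x for which the section of f is summable on B. *)
Definition partial_integral (B : set 'rV[R]_d)
    (f : 'rV[R]_(1 + d) -> option R) (x : 'rV[R]_1) : option R :=
  if `[< summable_on B (section_at f x) >]
  then Some (fine (integral_on B (section_at f x))) else None.

End Product.

(* Main.v *)
From HB Require Import structures.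
Require Import Defs.
From mathcomp Require Import all_boot all_order all_algebra.
From mathcomp Require Import all_classical all_reals all_analysis.
From mathcomp Require Import measurable_realfun ring lra.

Set Implicit Arguments.
Unset Strict Implicit.
Unset Printing Implicit Defensive.

Import Order.TTheory GRing.Theory Num.Theory.
Import numFieldNormedType.Exports.

Local Open Scope classical_set_scope.
Local Open Scope ring_scope.

(** On nonnegative functions the Tonelli integral is the Lebesgue integral, and
    for the Lebesgue integral the statement is the theorem of Fubini and
    Tonelli.  The work lies in the first half of this sentence.

    Lebesgue measure on R^n is built on the Borel sets of row vectors by
    iterating products with the measure of the line ([lebesgue_rV]), so that
    slicing off the first coordinate ([fubini_row_mx]) is available by
    construction.  A rectangle has its elementary volume as measure
    ([lebesgue_rV_rect]), hence a multirectangle D has measure at most L(D), and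
    sets that are null in the sense of coverings are negligible
    ([tonelli_null_negligible]).  A quasicontinuous f is continuous off open
    multirectangles of arbitrarily small measure; being continuous on each of
    the closed complements, it agrees with a Borel function g outside a
    negligible set ([quasicontinuous_representative]).

    The definition of the Tonelli integral is then followed upwards.  For a
    bounded continuous function the Riemann integral over the disk is the
    Lebesgue integral: Riemann sums are integrals of step functions that
    converge boundedly off the bounding sphere, which is negligible
    ([has_riemann_integral_disk]).  If f is bounded by M and G is a continuous
    function bounded by M that agrees with f off a multirectangle of size at
    most e, then the integrals of G and g over the disk differ by at most 2Me.
    So all admissible sequences of approximations give the same limit, the
    integral of g; such sequences exist by the extension theorem of Tietze, in a
    form that preserves extreme values ([bounded_integral_lebesgue]).
    Finally, the limit over growing disks and truncation heights is monotone
    convergence ([tonelli_pos_lebesgue]).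

    Now let f be as in the theorem, extended by 0, with Borel representative
    g >= 0.  The exceptional set is negligible, so by slicing the same holds on
    almost every section ([negligible_sections]).  Hence for almost every x the
    section of f has a Tonelli integral equal to the integral of g(x, .), and
    the inner integral of the theorem has the Borel representative
    x |-> int g(x, y) dy, whose integral is both the Tonelli integral of
    the inner integral and, by the theorem of Tonelli, the integral of g, that
    is, the Tonelli integral of f. *)

(** * Borel sets of row vectors *)

(** An alias of the type of row vectors that carries the Borel sigma-algebra. *)
Definition borel_rV (R : realType) (n : nat) :=
  g_sigma_algebraType (@open 'rV[R]_n).

Lemma measurable_forall_count d (T : measurableType d) (I : countType)
    (A : I -> set T) :
  (forall i, measurable (A i)) -> measurable [set x | forall i, A i x].
Proof.
move=> mA; rewrite (_ : [set x | _] = ~` (\bigcup_i ~` A i)).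
  apply/measurableC/countable_bigcupT_measurable => [|i].
    exact: countableP.
  exact: measurableC.
rewrite setC_bigcup; apply/seteqP; split=> x h i; first by move=> _; apply.
by apply: contrapT; exact: h i Logic.I.
Qed.

Section BorelRowVectors.
Variable R : realType.
Implicit Types n : nat.

Lemma open_measurable_rV n (A : set 'rV[R]_n) :
  open A -> measurable (A : set (borel_rV R n)).
Proof. exact: sub_gen_smallest. Qed.

Lemma closed_measurable_rV n (A : set 'rV[R]_n) :
  closed A -> measurable (A : set (borel_rV R n)).
Proof.
move=> cA; rewrite -(setCK A); apply: measurableC.
by apply: open_measurable_rV; exact: closed_openC.
Qed.

Lemma measurable_rV_of_opens d (T : measurableType d) n (D : set T)
    (f : T -> borel_rV R n) :
  (forall U : set 'rV[R]_n, open U -> measurable (D `&` f @^-1` U)) ->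
  measurable_fun D f.
Proof.
move=> h.
refine (@measurability _ _ T (borel_rV R n) D f (@open 'rV[R]_n) erefl _).
by move=> _ [U oU <-]; exact: h.
Qed.

Lemma within_continuous_measurable_rV n (C : set 'rV[R]_n) (f : 'rV[R]_n -> R) :
  closed C -> {within C, continuous f} ->
  measurable_fun (C : set (borel_rV R n)) f.
Proof.
move=> cC /continuousP cf.
apply: (measurability _ (RGenOpens.measurableE R)).
move=> _ [_ [a [b ->] <-]].
have oab : open (`]a, b[%classic : set R) by exact: interval_open.
have /open_subspaceP[V oV VE] := cf _ oab.
rewrite setIC (_ : _ `&` _ = V `&` C)//.
by apply: measurableI; [exact: open_measurable_rV|exact: closed_measurable_rV].
Qed.

Lemma continuous_measurable_rV n (f : 'rV[R]_n -> R) :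
  continuous f -> measurable_fun setT (f : borel_rV R n -> R).
Proof.
move=> cf; apply: within_continuous_measurable_rV; first exact: closedT.
exact: continuous_subspaceT.
Qed.

Lemma coord_continuous_rV n (k : 'I_n) :
  continuous (fun x : 'rV[R]_n => x 0 k).
Proof.
move=> x A /= nA; exists (fun i j => if j == k then A else setT).
  move=> i j; case: eqP => [->|_]; last exact: filterT.
  by rewrite ord1.
by move=> y /= /(_ 0 k); rewrite eqxx.
Qed.

Lemma measurable_coord n (k : 'I_n) :
  measurable_fun setT (fun x : borel_rV R n => x 0 k).
Proof. exact: continuous_measurable_rV (@coord_continuous_rV n k). Qed.

(** Second countability of R^n: boxes with rational centre and radius 1/(m+1)
    inside an open set already exhaust it.  This is what makes open sets
    measurable for the sigma-algebra generated by the coordinates. *)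
Lemma open_rV_rational_cover n (U : set 'rV[R]_n) : open U ->
  U = \bigcup_(p in [set p : 'rV[rat]_n * nat |
         [set x : 'rV[R]_n | forall k, `|ratr (p.1 0 k) - x 0 k| < p.2.+1%:R^-1]
           `<=` U])
      [set x : 'rV[R]_n | forall k, `|ratr (p.1 0 k) - x 0 k| < p.2.+1%:R^-1].
Proof.
move=> oU; apply/seteqP; split=> [x Ux|x [p /=]]; last by move=> /(_ x); apply.
have [e e0 eU] : exists2 e : R, 0 < e &
    forall y : 'rV[R]_n, (forall k, `|x 0 k - y 0 k| < e) -> U y.
  have /nbhs_ballP[e /= e0 he] := open_nbhs_nbhs (conj oU Ux).
  by exists e => // y hy; apply: he; split=> // i j; rewrite ord1; exact: hy.
have [m me] : exists m : nat, m.+1%:R^-1 < e / 2.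
  have [|m] := @ltr_add_invr R 0 (e / 2); first by rewrite divr_gt0.
  by rewrite add0r; exists m.
have q k : {q : rat | `|ratr q - x 0 k| < m.+1%:R^-1}.
  have h : x 0 k - m.+1%:R^-1 < x 0 k + m.+1%:R^-1.
    by rewrite ltrBlDr -addrA ltrDl addr_gt0.
  have /cid[q] := rat_in_itvoo h.
  by rewrite in_itv/= => hq; exists q; rewrite distrC ltr_distlC.
exists (\row_k sval (q k), m) => /=; last first.
  by move=> k; rewrite mxE; exact: svalP (q k).
move=> y /= hy; apply: eU => k.
rewrite -(subrKA (ratr (sval (q k)))).
rewrite (le_lt_trans (ler_normD _ _))// (splitr e) ltrD// (lt_trans _ me)//.
  by rewrite distrC; exact: svalP (q k).
by have := hy k; rewrite mxE.
Qed.

Lemma measurable_rV_coords d (T : measurableType d) n (f : T -> borel_rV R n) :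
  (forall k, measurable_fun setT (fun x => f x 0 k)) -> measurable_fun setT f.
Proof.
move=> mf; apply: measurable_rV_of_opens => U oU; rewrite setTI.
rewrite (open_rV_rational_cover oU) preimage_bigcup.
rewrite bigcup_mkcond; apply: countable_bigcupT_measurable => [|p].
  exact: countableP.
case: ifP => // _.
apply: (measurable_forall_count (A := fun k x =>
  ball (ratr (p.1 0 k) : R) p.2.+1%:R^-1 (f x 0 k))) => k.
by rewrite -[X in measurable X]setTI; apply: mf => //; exact: measurable_ball.
Qed.

End BorelRowVectors.

(** * Lebesgue measure on row vectors *)

Section ConsVector.
Variables (R : realType) (n : nat).

(** R x R^n and R^(1 + n) are isomorphic as measurable spaces through [cons_rV];
    Lebesgue measure is transported along it. *)
Definition cons_rV (p : R * 'rV[R]_n) : 'rV[R]_(1 + n) :=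
  row_mx (const_mx p.1) p.2.

Definition uncons_rV (z : 'rV[R]_(1 + n)) : R * 'rV[R]_n :=
  (z 0 (lshift n ord0), rsubmx z).

Lemma cons_rVl p (i : 'I_1) : cons_rV p 0 (lshift n i) = p.1.
Proof. by rewrite row_mxEl mxE. Qed.

Lemma cons_rVr p k : cons_rV p 0 (rshift 1 k) = p.2 0 k.
Proof. by rewrite row_mxEr. Qed.

Lemma cons_rVK : cancel cons_rV uncons_rV.
Proof. by case=> x y; rewrite /uncons_rV cons_rVl row_mxKr. Qed.

Lemma measurable_cons_rV :
  measurable_fun setT (cons_rV : R * borel_rV R n -> borel_rV R (1 + n)).
Proof.
apply: measurable_rV_coords => k; case: (split_ordP k) => j ->.
  rewrite (_ : (fun _ => _) = fst); first exact: measurable_fst.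
  by apply/funext => p; rewrite cons_rVl.
rewrite (_ : (fun _ => _) = (fun y : borel_rV R n => y 0 j) \o snd).
  by apply: measurableT_comp; [exact: measurable_coord|exact: measurable_snd].
by apply/funext => p; rewrite cons_rVr.
Qed.

Lemma measurable_uncons_rV :
  measurable_fun setT (uncons_rV : borel_rV R (1 + n) -> R * borel_rV R n).
Proof.
apply/measurable_fun_pairP; split; first exact: measurable_coord.
apply: measurable_rV_coords => k.
rewrite (_ : (fun _ => _) = (fun z : borel_rV R (1 + n) => z 0 (rshift 1 k))).
  exact: measurable_coord.
by apply/funext => z; rewrite /= mxE.
Qed.

Variable mu : {sigma_finite_measure set (borel_rV R n) -> \bar R}.

Definition lebesgue_cons : set (borel_rV R (1 + n)) -> \bar R :=
  pushforward (@lebesgue_measure R \x mu)%E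
    (cons_rV : R * borel_rV R n -> borel_rV R (1 + n)).

Let lebesgue_cons0 : lebesgue_cons set0 = 0%E.
Proof. by have mc := measurable_cons_rV; exact: measure0. Qed.

Let lebesgue_cons_ge0 A : (0 <= lebesgue_cons A)%E.
Proof. by have mc := measurable_cons_rV; exact: measure_ge0. Qed.

Let lebesgue_cons_sigma_additive : semi_sigma_additive lebesgue_cons.
Proof.
by have mc := measurable_cons_rV; exact: measure_semi_sigma_additive.
Qed.

HB.instance Definition _ := isMeasure.Build _ _ _ lebesgue_cons
  lebesgue_cons0 lebesgue_cons_ge0 lebesgue_cons_sigma_additive.

(* The inverse map pulls a product cover of R x R^n back to R^(1 + n). *)
Let lebesgue_cons_sigma_finite : sigma_finite setT lebesgue_cons.
Proof.
have /sigma_finiteP[F [FT ndF Foo]] := sigma_finiteT (@lebesgue_measure R).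
have /sigma_finiteP[G [GT ndG Goo]] := sigma_finiteT mu.
exists (fun i => uncons_rV @^-1` (F i `*` G i) : set (borel_rV R (1 + n))).
  rewrite -preimage_bigcup; apply/seteqP; split=> // z _.
  have [i _ Fi] : (\bigcup_i F i) (uncons_rV z).1 by rewrite -FT.
  have [j _ Gj] : (\bigcup_i G i) (uncons_rV z).2 by rewrite -GT.
  exists (maxn i j) => //; split.
    by move: Fi; apply/subsetPset/ndF/leq_maxl.
  by move: Gj; apply/subsetPset/ndG/leq_maxr.
move=> i; have [mF Fi] := Foo i; have [mG Gi] := Goo i; split.
  rewrite -[X in measurable X]setTI; apply: measurable_uncons_rV => //.
  exact: measurableX.
rewrite /lebesgue_cons /pushforward -comp_preimage.
rewrite (_ : _ \o _ = id); last by apply/funext; exact: cons_rVK.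
by rewrite preimage_id product_measure1E// lte_mul_pinfty// ge0_fin_numE.
Qed.

HB.instance Definition _ := Measure_isSigmaFinite.Build _ _ _ lebesgue_cons
  lebesgue_cons_sigma_finite.

Lemma lebesgue_cons_integral (f : borel_rV R (1 + n) -> \bar R) :
  measurable_fun [set: borel_rV R (1 + n)] f -> (forall z, 0 <= f z)%E ->
  (\int[lebesgue_cons]_z f z =
   \int[lebesgue_measure]_x \int[mu]_y f (cons_rV (x, y)))%E.
Proof.
move=> mf f0; have mc := measurable_cons_rV.
rewrite ge0_integral_pushforward// preimage_setT fubini_tonelli1//.
  exact: measurableT_comp.
by move=> p; exact: f0.
Qed.

End ConsVector.

Section LebesgueMeasure.
Variable R : realType.

(** Bundling sigma-finiteness in the recursion is what allows the product with
    the line to be formed again at the next stage. *)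
Fixpoint lebesgue_rV n : {sigma_finite_measure set (borel_rV R n) -> \bar R} :=
  match n with
  | 0 => \d_(0 : borel_rV R 0)
  | n'.+1 => lebesgue_cons (lebesgue_rV n')
  end.

Lemma lebesgue_rVS n (A : set (borel_rV R (1 + n))) :
  lebesgue_rV (1 + n) A =
  (@lebesgue_measure R \x lebesgue_rV n)%E (@cons_rV R n @^-1` A).
Proof. by []. Qed.

Lemma lebesgue_rV_fubini n (f : borel_rV R (1 + n) -> \bar R) :
  measurable_fun [set: borel_rV R (1 + n)] f -> (forall z, 0 <= f z)%E ->
  (\int[lebesgue_rV (1 + n)]_z f z =
   \int[lebesgue_measure]_x \int[lebesgue_rV n]_y f (cons_rV (x, y)))%E.
Proof. exact: lebesgue_cons_integral. Qed.

Lemma measurable_rect_set n (I : rectangle R n) :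
  measurable (rect_set I : set (borel_rV R n)).
Proof.
apply: (measurable_forall_count
  (A := fun k (x : borel_rV R n) => x 0 k \in I k)) => k.
have := @measurable_coord R n k measurableT _ (measurable_itv (I k)).
by rewrite setTI.
Qed.

Lemma lebesgue_rV_rect n (I : rectangle R n) :
  lebesgue_rV n (rect_set I) = rect_L I.
Proof.
elim: n I => [|n IH] I.
  rewrite /rect_L big_ord0 /= diracE mem_set//.
  by case.
rewrite /rect_L big_ord_recl.
have e0 : ord0 = lshift n ord0 :> 'I_(1 + n) by exact: val_inj.
pose J : rectangle R n := fun k => I (rshift 1 k).
transitivity ((@lebesgue_measure R \x lebesgue_rV n)%E
    ([set` I ord0] `*` rect_set J)).
  rewrite (lebesgue_rVS (rect_set (I : rectangle R (1 + n)))).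
  congr (_ _); apply/seteqP; split=> -[t y] /=.
    move=> h; split; first by have := h (lshift n ord0); rewrite cons_rVl -e0.
    by move=> k; have := h (rshift 1 k); rewrite cons_rVr.
  case=> h1 h2 k; case: (split_ordP (k : 'I_(1 + n))) => j ->.
    by rewrite (ord1 j) cons_rVl -e0.
  by rewrite cons_rVr; exact: h2.
have mJ := measurable_rect_set J.
rewrite product_measure1E; [|exact: measurable_itv|exact: mJ].
congr (_ * _)%E.
  have er_id (x : \bar R) : er_map idfun x = x by case: x.
  by rewrite /= lebesgue_measure_itv wlength_itv !er_id.
rewrite IH; apply: eq_bigr => k _; rewrite /J.
by have -> : rshift 1 k = lift ord0 k :> 'I_(1 + n) by exact: val_inj.
Qed.

Lemma eucl_norm_continuous n : continuous (@eucl_norm R n).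
Proof.
have sumc s : continuous (fun x : 'rV[R]_n => \sum_(k <- s) x 0 k ^+ 2).
  elim: s => [|k s IH] x.
    rewrite (_ : (fun _ => _) = cst 0); first exact: cst_continuous.
    by apply/funext => y; rewrite big_nil.
  rewrite (_ : (fun _ => _) =
      (fun y : 'rV[R]_n => y 0 k * y 0 k + \sum_(k <- s) y 0 k ^+ 2)).
    apply: (@continuousD _ _ _ (fun y : 'rV[R]_n => y 0 k * y 0 k));
      last exact: IH.
    by apply: (@continuousM _ _ (fun y : 'rV[R]_n => y 0 k));
      exact: coord_continuous_rV.
  by apply/funext => y; rewrite big_cons expr2.
by move=> x; apply: continuous_comp; [exact: sumc|exact: sqrt_continuous].
Qed.

Lemma eucl_norm_ge n (x : 'rV[R]_n) k : `|x 0 k| <= eucl_norm x.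
Proof.
rewrite -sqrtr_sqr ler_wsqrtr// (bigD1 k)//= lerDl sumr_ge0// => i _.
exact: sqr_ge0.
Qed.

Lemma disk_subset_cube n (r : R) (x : 'rV[R]_n) :
  disk r%:E x -> forall k, `|x 0 k| <= r.
Proof.
by move=> xr k; apply: le_trans (eucl_norm_ge x k) _; rewrite -lee_fin.
Qed.

Lemma disk_closed n (r : R) : closed (@disk R n r%:E).
Proof.
rewrite (_ : disk _ = @eucl_norm R n @^-1` [set t | t <= r]).
  move/continuous_closedP: (@eucl_norm_continuous n); apply; exact: closed_le.
by apply/seteqP; split=> x /=; rewrite /disk/= lee_fin.
Qed.

Lemma measurable_disk n (r : R) : measurable (disk r%:E : set (borel_rV R n)).
Proof. by apply: closed_measurable_rV; exact: disk_closed. Qed.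

Lemma rect_L_const n (i : interval R) (c : R) :
  wlength idfun [set` i] = c%:E -> rect_L (fun _ : 'I_n => i) = (c ^+ n)%:E.
Proof.
move=> ic; rewrite /rect_L; under eq_bigr do rewrite ic.
by rewrite prodEFin prodr_const card_ord.
Qed.

Lemma lebesgue_disk_lty n (r : R) : (lebesgue_rV n (disk r%:E) < +oo)%E.
Proof.
pose I : rectangle R n := fun=> `[-r, r].
apply: (@le_lt_trans _ _ (lebesgue_rV n (rect_set I))).
  apply: le_measure; rewrite ?inE; [exact: measurable_disk| |].
    exact: measurable_rect_set.
  move=> x /disk_subset_cube xr k.
  by rewrite in_itv/= -ler_norml.
rewrite lebesgue_rV_rect.
have [c ic] : exists c : R, wlength idfun `[-r, r]%classic = c%:E.
  by rewrite wlength_itv/=; case: ifP => _; [exists (r - -r)|exists 0].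
by rewrite (rect_L_const n ic) ltry.
Qed.

(** The disk of radius r contains the cube of half-side r / (n + 1). *)
Lemma lebesgue_disk_gt0 n (r : R) : 0 < r -> (0 < lebesgue_rV n (disk r%:E))%E.
Proof.
move=> r0; pose s := r / n.+1%:R.
have s0 : 0 < s by rewrite divr_gt0.
pose I : rectangle R n := fun=> `[-s, s].
apply: (@lt_le_trans _ _ (lebesgue_rV n (rect_set I))).
  rewrite lebesgue_rV_rect (@rect_L_const _ _ (s + s)) ?lte_fin ?exprn_gt0
    ?addr_gt0//.
  rewrite wlength_itv/= lte_fin ifT ?opprK//.
  by rewrite (@lt_trans _ _ 0)// oppr_lt0.
apply: le_measure; rewrite ?inE; 
  [exact: measurable_rect_set|exact: measurable_disk|].
move=> x Ix; rewrite /disk/= lee_fin -(ger0_norm (ltW r0)) -sqrtr_sqr.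
rewrite ler_wsqrtr//.
apply: (@le_trans _ _ (\sum_(k < n) s ^+ 2)).
  apply: ler_sum => k _; have := Ix k; rewrite in_itv/= -ler_norml => xs.
  by rewrite -(real_normK (num_real (x 0 k))) lerXn2r// nnegrE ltW.
rewrite sumr_const card_ord -mulr_natl exprMn mulrCA ler_piMr ?sqr_ge0//.
rewrite exprVn ler_pdivrMr ?exprn_gt0// mul1r -natrX ler_nat.
by rewrite (@leq_trans n.+1)// -{1}(expn1 n.+1) leq_pexp2l.
Qed.

Lemma measurable_sphere n (r : R) :
  measurable [set x : borel_rV R n | eucl_norm x = r].
Proof.
apply: closed_measurable_rV.
rewrite (_ : [set x | _] = @eucl_norm R n @^-1` [set r]) //.
by move/continuous_closedP: (@eucl_norm_continuous n); apply; exact: closed_eq.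
Qed.

(** With the last n coordinates fixed, a point of the sphere has at most two
    possible first coordinates: integrate over the first coordinate first. *)
Lemma sphere_null n (r : R) :
  lebesgue_rV (1 + n) [set x : borel_rV R (1 + n) | eucl_norm x = r] = 0%E.
Proof.
set S := [set x | _].
have mS : measurable S by exact: measurable_sphere.
have mSc : measurable (@cons_rV R n @^-1` S : set (R * borel_rV R n)).
  by rewrite -[X in measurable X]setTI; exact: measurable_cons_rV.
rewrite lebesgue_rVS.
rewrite (@product_measure_unique _ _ _ _ _ _ _
  (@lebesgue_measure R \x^ lebesgue_rV n)%E)//; last first.
  by move=> A B mA mB; exact: product_measure2E.
rewrite /= /product_measure2 integral0_eq// => y _ /=.
apply: countable_lebesgue_measure0.
pose c := Num.sqrt (r ^+ 2 - \sum_(k < n) y 0 k ^+ 2).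
apply: (@sub_countable _ _ _ [set c; - c]); last exact: finite_set_countable.
apply: subset_card_le => t /=; rewrite /ysection/= inE /S/= => tr.
have E : r ^+ 2 - \sum_(k < n) y 0 k ^+ 2 = t ^+ 2.
  rewrite -tr sqr_sqrtr; last by apply: sumr_ge0 => k _; exact: sqr_ge0.
  rewrite big_split_ord/= big_ord1 cons_rVl/=.
  by under eq_bigr do rewrite cons_rVr; rewrite addrK.
have : t ^+ 2 = c ^+ 2 by rewrite /c E sqr_sqrtr// sqr_ge0.
by move/eqP; rewrite eqf_sqr => /orP[]/eqP ->; [left|right].
Qed.

End LebesgueMeasure.

(** * Null sets and Borel representatives *)

Section Representative.
Variables (R : realType) (n : nat).
Implicit Types (f : 'rV[R]_n -> option R) (D : multirectangle R n).

Lemma measurable_mrect_set D : measurable (mrect_set D : set (borel_rV R n)).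
Proof. by apply: bigcupT_measurable => j; exact: measurable_rect_set. Qed.

Lemma lebesgue_mrect_le D : (lebesgue_rV R n (mrect_set D) <= mrect_L D)%E.
Proof.
rewrite /mrect_L; under eq_eseriesr do rewrite -lebesgue_rV_rect.
apply: measure_sigma_subadditive => //; last exact: measurable_mrect_set.
by move=> j; exact: measurable_rect_set.
Qed.

Lemma negligible_of_small_mrects (D : nat -> multirectangle R n) :
  (forall j, mrect_L (D j) < (j.+1%:R^-1)%:E)%E ->
  (lebesgue_rV R n).-negligible (\bigcap_j mrect_set (D j)).
Proof.
move=> DL.
have mN : measurable (\bigcap_j mrect_set (D j) : set (borel_rV R n)).
  by apply: bigcapT_measurable => j; exact: measurable_mrect_set.
apply/negligibleP => //; apply/eqP; rewrite eq_le measure_ge0 andbT.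
apply/lee_addgt0Pr => e e0; rewrite add0e.
have [|m] := @ltr_add_invr R 0 e; first by [].
rewrite add0r => me.
apply: (@le_trans _ _ (lebesgue_rV R n (mrect_set (D m)))).
  apply: le_measure; rewrite ?inE//; first exact: measurable_mrect_set.
  exact: bigcap_inf.
apply: le_trans (lebesgue_mrect_le _) _.
by apply/ltW/(lt_trans (DL m)); rewrite lte_fin.
Qed.

Lemma tonelli_null_negligible (A : set 'rV[R]_n) :
  tonelli_null A -> (lebesgue_rV R n).-negligible A.
Proof.
move=> nA.
have H j : exists D, (mrect_L D < (j.+1%:R^-1)%:E)%E /\ A `<=` mrect_set D.
  by apply: nA; rewrite invr_gt0.
have [D HD] := choice H.
apply: (negligibleS _ (negligible_of_small_mrects (fun j => (HD j).1))).
by move=> x Ax j _; exact: (HD j).2.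
Qed.

(** Let C_j be the closed complement of a multirectangle of size below 1/(j+1)
    off which f is continuous.  On the union of the C_j the function f is Borel,
    and the complement of that union is covered by multirectangles of
    arbitrarily small size; the representative is 0 there. *)
Lemma quasicontinuous_representative f : quasicontinuous +oo%E f ->
  exists g : borel_rV R n -> R, [/\ measurable_fun setT g,
    (lebesgue_rV R n).-negligible [set x | f x <> Some (g x)]
    & forall x, g x = 0 \/ f x = Some (g x)].
Proof.
move=> qf.
have H j : exists D, continuous_off +oo%E f (j.+1%:R^-1) D.
  by apply: qf; rewrite invr_gt0.
have [D HD] := choice H.
have dT : disk +oo%E = [set: 'rV[R]_n].
  by apply/seteqP; split=> x // _; rewrite /disk/= leey.
pose C j : set (borel_rV R n) := ~` mrect_set (D j).
have mC j : measurable (C j) by apply: measurableC; exact: measurable_mrect_set.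
have fC x j : C j x -> f x = Some (odflt 0 (f x)).
  move=> Cx; have [_ _ + _] := HD j; rewrite dT setTD => /(_ x Cx) /=.
  by case: (f x).
exists ((odflt 0 \o f) \_ (\bigcup_j C j)); split.
- apply/(measurable_restrictT _ _).1; first exact: bigcupT_measurable.
  apply/measurable_fun_bigcup => // j.
  have [_ oD _] := HD j; rewrite dT setTD => cf.
  by apply: within_continuous_measurable_rV => //; exact: open_closedC.
- apply: (negligibleS _ (@negligible_of_small_mrects D _)).
    move=> x /= fx j _; apply: contrapT => Cx; apply: fx.
    rewrite patchE mem_set; last by exists j.
    exact: (fC x j).
  by move=> j; have [] := HD j.
- move=> x; rewrite patchE; case: ifPn => [/set_mem[j _ Cx]|]; last by left.
  by right; exact: (fC x j).
Qed.

End Representative.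

(** * Riemann integrals over a disk as Lebesgue integrals *)

Section StepFunctions.
Variables (R : realType) (n : nat).
Implicit Types (lo hi x : 'rV[R]_n) (h : 'rV[R]_n -> R).

Local Notation mu := (lebesgue_rV R n).

(** Cells are half-open so that they are pairwise disjoint and fill the box
    lo < x <= hi exactly. *)
Definition grid_cell m (p : 'I_n -> nat -> R) (c : {ffun 'I_n -> 'I_m}) :
    set (borel_rV R n) :=
  rect_set (fun k => `]p k (c k), p k (c k).+1]).

(** The step function whose Lebesgue integral is the Riemann sum of h. *)
Definition grid_step h m (p : 'I_n -> nat -> R)
    (t : {ffun 'I_n -> 'I_m} -> 'rV[R]_n) (x : borel_rV R n) : R :=
  \sum_(c : {ffun 'I_n -> 'I_m}) h (t c) * \1_(grid_cell p c) x.

Lemma measurable_grid_step h m p (t : {ffun 'I_n -> 'I_m} -> 'rV[R]_n) :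
  measurable_fun setT (grid_step h p t).
Proof.
apply: measurable_sum => c; apply: measurable_funM => //.
by apply: measurable_indic; exact: measurable_rect_set.
Qed.

Lemma sum_subintervals (q : nat -> R) m (s : R) :
  (forall j, (j < m)%N -> q j <= q j.+1) ->
  \sum_(j < m) (s \in `]q j, q j.+1])%:R = (s \in `]q 0%N, q m])%:R :> R.
Proof.
elim: m => [|j IH] qk; first by rewrite big_ord0 in_itv/= lt_le_asym.
have qS i : (i < j)%N -> q i <= q i.+1 by move=> ij; apply/qk/ltnW.
rewrite big_ord_recr/= IH//.
have q0j : q 0%N <= q j.
  elim: j qS {IH qk} => // j IHj qS.
  by apply: le_trans (qS j _) => //; apply: IHj => i ij; apply/qS/ltnW.
have qj := qk j (leqnn _).
rewrite !in_itv/=; case: (leP s (q j)) => sj.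
  by rewrite (le_trans sj qj) addr0.
by rewrite andbF add0r (le_lt_trans q0j sj).
Qed.

Section TaggedGrid.
Variables (lo hi : 'rV[R]_n) (delta : R) (m : nat) (p : 'I_n -> nat -> R).
Variable t : {ffun 'I_n -> 'I_m} -> 'rV[R]_n.
Hypothesis pt : tagged_grid lo hi delta p t.

Lemma lebesgue_grid_cell (c : {ffun 'I_n -> 'I_m}) :
  mu (grid_cell p c) = (\prod_(k < n) (p k (c k).+1 - p k (c k)))%:E.
Proof.
have [_ _ pinc _] := pt.
rewrite /grid_cell lebesgue_rV_rect /rect_L -prodEFin; apply: eq_bigr => k _.
rewrite wlength_itv/= lte_fin; case: ltP => // pk.
have /andP[pk' _] := pinc k (c k) (ltn_ord _).
by congr (_%:E); apply/eqP; rewrite eq_sym subr_eq0 eq_le pk pk'.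
Qed.

Lemma integral_grid_step h :
  (\int[mu]_x (grid_step h p t x)%:E = (riemann_sum h p t)%:E)%E.
Proof.
have mcell c : measurable (grid_cell p c) by exact: measurable_rect_set.
have E c : (fun x => (h (t c) * \1_(grid_cell p c) x)%:E) =
    (cst (h (t c))%:E) \_ (grid_cell p c).
  apply/funext => x; rewrite patchE indicE.
  by case: ifPn => _; rewrite ?mulr1// mulr0.
under eq_integral do rewrite /grid_step -sumEFin.
rewrite integral_sum//; last first.
  move=> c; rewrite E; apply: (iffLR (integrable_mkcond _ (mcell _ c))).
  rewrite (_ : cst _ = EFin \o cst (h (t c)))//.
  apply: measurable_bounded_integrable => //.
    by rewrite [ltLHS]lebesgue_grid_cell ltry.
  exact: bounded_cst.
rewrite /riemann_sum -sumEFin; apply: eq_bigr => c _.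
rewrite E -integral_mkcond integral_cst// EFinM; congr (_ * _)%E.
exact: lebesgue_grid_cell.
Qed.

(** Every point of the half-open box lies in exactly one cell.  The indicator of
    a cell is a product over the axes, so that the sum over cells factors into
    sums over the subintervals of each axis. *)
Lemma sum_grid_cells x :
  \sum_(c : {ffun 'I_n -> 'I_m}) \1_(grid_cell p c) x
  = \1_(rect_set (fun k => `]lo 0 k, hi 0 k])) x :> R.
Proof.
have [p0 pm pinc _] := pt.
have indic_rect (I : rectangle R n) :
    \1_(rect_set I) x = \prod_(k < n) (x 0 k \in I k)%:R :> R.
  rewrite indicE; case: (boolP (x \in _)) => [/set_mem xI|/negP xI].
    by rewrite big1// => k _; rewrite xI.
  have [k /negP/negPf xk] : exists k, ~ x 0 k \in I k.
    by apply/existsNP => xI'; apply: xI; rewrite inE.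
  by rewrite (bigD1 k)//= xk mul0r.
rewrite indic_rect; under eq_bigr do rewrite indic_rect.
rewrite -(bigA_distr_bigA (fun k (j : 'I_m) =>
  (x 0 k \in `]p k j, p k j.+1])%:R)).
apply: eq_bigr => k _; rewrite -p0 -pm.
by apply: sum_subintervals => j /(pinc k j)/andP[].
Qed.

Lemma grid_step_bound h M x : (forall y, `|h y| <= M) ->
  `|grid_step h p t x| <= M * \1_(rect_set (fun k => `]lo 0 k, hi 0 k])) x.
Proof.
move=> hM; rewrite -sum_grid_cells mulr_sumr.
apply: le_trans (ler_norm_sum _ _ _) _; apply: ler_sum => c _.
by rewrite normrM [X in _ * X]ger0_norm// ler_wpM2r.
Qed.

Lemma grid_step_close h (e : R) x : 0 <= delta ->
  (forall y : 'rV[R]_n, (forall k, `|y 0 k - x 0 k| <= delta) ->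
    `|h y - h x| <= e) ->
  `|grid_step h p t x
    - h x * \1_(rect_set (fun k => `]lo 0 k, hi 0 k])) x| <= e.
Proof.
have [_ _ pinc pt'] := pt => delta0 he.
have e0 : 0 <= e.
  by have := he x; rewrite subrr normr0; apply=> k; rewrite subrr normr0.
rewrite -sum_grid_cells mulr_sumr /grid_step -sumrB.
apply: (@le_trans _ _
    (\sum_(c : {ffun 'I_n -> 'I_m}) e * \1_(grid_cell p c) x)).
  apply: le_trans (ler_norm_sum _ _ _) _; apply: ler_sum => c _.
  rewrite -mulrBl normrM [X in _ * X]ger0_norm//.
  rewrite indicE; case: (boolP (x \in _)) => [/set_mem xc|_];
    last by rewrite !mulr0.
  rewrite !mulr1; apply: he => k.
  have /andP[t1 t2] := pt' c k.
  have := xc k; rewrite in_itv/= => /andP[x1 x2].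
  have /andP[_ d] := pinc k (c k) (ltn_ord _).
  by rewrite ler_norml; apply/andP; split; lra.
by rewrite -mulr_sumr sum_grid_cells ler_piMr// indicE.
Qed.

End TaggedGrid.
End StepFunctions.

Section RiemannIntegral.
Variables (R : realType) (n : nat).
Hypothesis n_gt0 : (0 < n)%N.
Variables (r : R) (g : 'rV[R]_n -> R) (M : R).
Hypotheses (g_cont : continuous g) (gM : forall x, `|g x| <= M).

Local Notation mu := (lebesgue_rV R n).
Local Notation h := (fun x : 'rV[R]_n => \1_(disk r%:E) x * g x).

Let cube : set (borel_rV R n) := rect_set (fun=> `]-r, r]).

Lemma disk_indic_bound x : `|h x| <= M.
Proof.
rewrite /= normrM indicE; case: (x \in _); rewrite ?normr1 ?mul1r//.
by rewrite normr0 mul0r (le_trans _ (gM x)).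
Qed.

Lemma disk_indic_in x : eucl_norm x <= r -> h x = g x.
Proof. by move=> xr; rewrite /= indicE mem_set ?mul1r// /disk/= lee_fin. Qed.

Lemma disk_indic_out x : r < eucl_norm x -> h x = 0.
Proof.
move=> rx; rewrite /= indicE memNset ?mul0r// /disk/= lee_fin.
by apply/negP; rewrite -ltNge.
Qed.

Lemma disk_indic_continuous x : eucl_norm x <> r -> {for x, continuous h}.
Proof.
move=> /eqP; rewrite neq_lt => /orP[xr|rx].
  have near_lt : \forall y \near x, eucl_norm y < r.
    exact: (cvgr_lt _ (@eucl_norm_continuous R n x)).
  apply: (@cvg_trans _ (g @ x)); last first.
    rewrite /prop_for /continuous_at /= (disk_indic_in (ltW xr)).
    exact: g_cont.
  have gh : \forall y \near x, g y = h y.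
    by apply: filterS near_lt => y yr; exact/esym/disk_indic_in/ltW.
  exact: near_eq_cvg gh.
have near_gt : \forall y \near x, r < eucl_norm y.
  exact: (cvgr_gt _ (@eucl_norm_continuous R n x)).
apply: (@cvg_trans _ (cst 0 @ x)); last first.
  rewrite /prop_for /continuous_at /= (disk_indic_out rx).
  exact: (@cst_continuous _ _ (0 : R) x).
have zh : \forall y \near x, cst 0 y = h y.
  by apply: filterS near_gt => y ry; exact/esym/disk_indic_out.
exact: near_eq_cvg zh.
Qed.

(** The step functions vanish outside the half-open cube; the disk leaves it
    only at points of the sphere. *)
Lemma disk_indic_cube x : eucl_norm x <> r -> h x * \1_cube x = h x.
Proof.
move=> /eqP; rewrite neq_lt => /orP[xr|rx].
  rewrite [X in _ * X]indicE mem_set ?mulr1// => k.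
  rewrite in_itv/=; have := le_lt_trans (eucl_norm_ge x k) xr.
  by rewrite ltr_norml => /andP[-> /ltW].
by rewrite disk_indic_out// mul0r.
Qed.

Lemma measurable_disk_indic : measurable_fun setT (h : borel_rV R n -> R).
Proof.
apply: measurable_funM; last exact: continuous_measurable_rV.
by apply: measurable_indic; exact: measurable_disk.
Qed.

Lemma lebesgue_cube_lty : (mu cube < +oo)%E.
Proof.
rewrite [ltLHS]lebesgue_rV_rect.
have [c ic] : exists c : R, wlength idfun `]-r, r]%classic = c%:E.
  by rewrite wlength_itv/=; case: ifP => _; [exists (r - -r)|exists 0].
by rewrite (rect_L_const n ic) ltry.
Qed.

(** Otherwise there are grids of mesh 1/(k+1) with Riemann sums at a fixed
    distance from the Lebesgue integral.  Their step functions are dominated by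
    M times the indicator of the cube and converge at every continuity point of
    the integrand, that is, off the sphere, which contradicts dominated
    convergence. *)
Lemma has_riemann_integral_disk :
  has_riemann_integral (const_mx (- r)) (const_mx r) h
    (fine (\int[mu]_x (h x)%:E)%E).
Proof.
apply: contrapT => /existsNP[eps /not_implyP[eps0 noeps]].
have far k : exists sS : (borel_rV R n -> R) * R,
    [/\ measurable_fun setT sS.1,
        (\int[mu]_x (sS.1 x)%:E = sS.2%:E)%E,
        eps <= `|sS.2 - fine (\int[mu]_x (h x)%:E)%E|,
        forall x : 'rV[R]_n, `|sS.1 x| <= M * \1_cube x &
        forall (e : R) (x : 'rV[R]_n), (forall y : 'rV[R]_n,
            (forall i, `|y 0 i - x 0 i| <= k.+1%:R^-1) -> `|h y - h x| <= e) ->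
          `|sS.1 x - h x * \1_cube x| <= e].
  have cubeE : cube = rect_set (fun i : 'I_n =>
      `](const_mx (- r) : 'rV[R]_n) 0 i, (const_mx r : 'rV[R]_n) 0 i]).
    by apply/seteqP; split=> x xc i; have := xc i; rewrite !mxE.
  have : exists m (p : 'I_n -> nat -> R) (t : {ffun 'I_n -> 'I_m} -> 'rV[R]_n),
      tagged_grid (const_mx (- r)) (const_mx r) k.+1%:R^-1 p t /\
      eps <= `|riemann_sum h p t - fine (\int[mu]_x (h x)%:E)%E|.
    apply: contrapT => no; apply: noeps; exists k.+1%:R^-1.
      by rewrite invr_gt0.
    move=> m p t pt; rewrite ltNge; apply/negP => le_eps.
    by apply: no; exists m, p, t.
  move=> [m [p [t [pt le_eps]]]].
  exists (grid_step h p t, riemann_sum h p t); split => //=.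
  - exact: measurable_grid_step.
  - exact: integral_grid_step pt _.
  - move=> x; rewrite cubeE; apply: (grid_step_bound pt).
    exact: disk_indic_bound.
  - by move=> e x he; rewrite cubeE; apply: (grid_step_close pt).
have [sS HsS] := choice far.
have int_dom : mu.-integrable setT (fun x => (M * \1_cube x)%:E).
  have mcube : measurable cube by exact: measurable_rect_set.
  rewrite (_ : (fun _ => _) = (EFin \o cst M) \_ cube); last first.
    apply/funext => x; rewrite patchE indicE.
    by case: ifPn => _; rewrite ?mulr1// mulr0.
  apply: (iffLR (integrable_mkcond _ mcube)).
  apply: measurable_bounded_integrable => //; first exact: lebesgue_cube_lty.
  exact: bounded_cst.
have ae_cvg : {ae mu, forall x, setT x ->
    ((sS k).1 x)%:E @[k --> \oo] --> (h x)%:E}.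
  have sphere_negl : mu.-negligible [set x : borel_rV R n | eucl_norm x = r].
    case: (n) n_gt0 => // n' _; apply/negligibleP; last exact: sphere_null.
    exact: measurable_sphere.
  apply: negligibleS sphere_negl => x /= nx.
  apply: contrapT => xr; apply: nx => _.
  apply: cvg_EFin; first exact: nearW.
  apply/cvgrPdist_le => e e0.
  have hx := disk_indic_continuous xr.
  have /nbhs_ballP[del /= del0 hdel] : nbhs x [set y | `|h x - h y| <= e].
    exact: (cvgrPdist_le _ _).1 hx e e0.
  have [|K] := @ltr_add_invr R 0 del; first by [].
  rewrite add0r => Kdel; near=> k.
  have [_ _ _ _ close] := HsS k.
  rewrite distrC -(disk_indic_cube xr); apply: close => y xy.
  rewrite distrC; apply: hdel; split=> // i j; rewrite ord1.
  rewrite /ball/= distrC; apply: le_lt_trans (xy j) _.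
  apply: le_lt_trans Kdel; rewrite lef_pV2 ?posrE// ler_nat ltnS.
  by near: k; exact: nbhs_infty_ge.
have ms k : measurable_fun setT (fun x => ((sS k).1 x)%:E).
  by apply/measurable_EFinP; have [] := HsS k.
have mh : measurable_fun setT (fun x : borel_rV R n => (h x)%:E).
  by apply/measurable_EFinP; exact: measurable_disk_indic.
have s_dom : {ae mu, forall x k, setT x ->
    `|((sS k).1 x)%:E| <= (M * \1_cube x)%:E}%E.
  by apply: aeW => x k _; have [_ _ _ b _] := HsS k; rewrite abse_EFin lee_fin.
have [int_h _ cvg_int] := 
  dominated_convergence measurableT ms mh ae_cvg int_dom s_dom.
have : (sS k).2 @[k --> \oo] --> fine (\int[mu]_x (h x)%:E)%E.
  have int_fin : (\int[mu]_x (h x)%:E)%E \is a fin_num.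
    exact: integrable_fin_num.
  move: cvg_int; rewrite -[X in _ --> X](fineK int_fin) => /fine_cvg.
  rewrite (_ : fine \o _ = fun k => (sS k).2)//.
  by apply/funext => k /=; have [_ -> _ _ _] := HsS k.
move/cvgrPdist_lt => /(_ eps eps0) [K _ /(_ K (leqnn K))] /=.
by have [_ _ + _ _] := HsS K; rewrite distrC leNgt => /negP.
Unshelve. all: by end_near. Qed.

End RiemannIntegral.

Section RiemannValue.
Variables (R : realType) (n : nat).
Implicit Types (h g : 'rV[R]_n -> R).

Lemma tagged_grid_exists (r delta : R) : 0 < r -> 0 < delta ->
  exists m (p : 'I_n -> nat -> R) (t : {ffun 'I_n -> 'I_m} -> 'rV[R]_n),
    tagged_grid (const_mx (- r)) (const_mx r) delta p t.
Proof.
move=> r0 delta0.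
have [|N] := @ltr_add_invr R 0 (delta / (r + r)).
  by rewrite divr_gt0// addr_gt0.
rewrite add0r ltr_pdivlMr ?addr_gt0// mulrC => Ndelta.
pose q j : R := - r + (r + r) * (j%:R / N.+1%:R).
have qS j : q j.+1 = q j + (r + r) / N.+1%:R.
  by rewrite /q -[j.+1%:R]natr1; ring.
have step0 : 0 <= (r + r) / N.+1%:R by rewrite divr_ge0// addr_ge0// ltW.
exists N.+1, (fun _ => q),
  (fun c : {ffun 'I_n -> 'I_N.+1} => \row_k q (c k)); split.
- by move=> k; rewrite mxE /q mul0r mulr0 addr0.
- by move=> k; rewrite mxE /q divff// mulr1 addrA addNr add0r.
- by move=> k j _; rewrite qS lerDl step0 ltrD2l.
- by move=> c k; rewrite mxE lexx qS lerDl.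
Qed.

Lemma has_riemann_integral_unique (r : R) h v w : 0 < r ->
  has_riemann_integral (const_mx (- r)) (const_mx r) h v ->
  has_riemann_integral (const_mx (- r)) (const_mx r) h w -> v = w.
Proof.
move=> r0 hv hw; apply/eqP; rewrite -subr_eq0 -normr_le0.
apply/ler_addgt0Pr => e e0; rewrite add0r.
have e20 : 0 < e / 2 by rewrite divr_gt0.
have [d1 d10 H1] := hv _ e20; have [d2 d20 H2] := hw _ e20.
have [|m [p [t [p0 pm pinc ptag]]]] := @tagged_grid_exists r (Num.min d1 d2) r0.
  by rewrite lt_min d10.
have P1 : tagged_grid (const_mx (- r)) (const_mx r) d1 p t.
  split=> // k j jm; have /andP[-> /= p2] := pinc k j jm.
  by rewrite (lt_le_trans p2)// lerD2l ge_min lexx.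
have P2 : tagged_grid (const_mx (- r)) (const_mx r) d2 p t.
  split=> // k j jm; have /andP[-> /= p2] := pinc k j jm.
  by rewrite (lt_le_trans p2)// lerD2l ge_min lexx orbT.
rewrite -(subrKA (riemann_sum h p t)) (splitr e).
rewrite (le_trans (ler_normD _ _))// lerD// ltW//; last exact: H2.
by rewrite distrC; exact: H1.
Qed.

Lemma riemann_integral_lebesgue (r : R) g (M : R) : (0 < n)%N -> 0 < r ->
  continuous g -> (forall x, `|g x| <= M) ->
  riemann_integral r g =
  fine (\int[lebesgue_rV R n]_x (\1_(disk r%:E) x * g x)%:E)%E.
Proof.
move=> n0 r0 cg gM; have H := has_riemann_integral_disk n0 r cg gM.
apply: (has_riemann_integral_unique r0 _ H).
by apply: (@getPex _ (has_riemann_integral _ _ _)); exists (fine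
  (\int[lebesgue_rV R n]_x (\1_(disk r%:E) x * g x)%:E)%E).
Qed.

End RiemannValue.

(** * Continuous extension with the same extreme values *)

Section TietzeExtremes.
Variables (R : realType) (X : topologicalType).
Hypothesis normalX : normal_space X.

(** The extension theorem of Tietze preserves the bound of |f|, so it is applied
    to f minus the midpoint a of the range of f, with bound the half-width b.
    It requires b > 0; for b = 0 the function f is constant on C. *)
Lemma continuous_extension_same_extremes (C : set X) (f : X -> R) (M : R) :
  closed C -> C !=set0 -> {within C, continuous f} ->
  (forall x, C x -> `|f x| <= M) ->
  exists g : X -> R, [/\ continuous g, forall x, C x -> f x = g x,
    ereal_inf (range (EFin \o g)) = ereal_inf ((EFin \o g) @` C) &
    ereal_sup (range (EFin \o g)) = ereal_sup ((EFin \o g) @` C)].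
Proof.
move=> cC C0 cf fM.
have ub : has_ubound (f @` C).
  by exists M => _ [x Cx <-]; have := fM x Cx; rewrite ler_norml => /andP[].
have lb : has_lbound (f @` C).
  by exists (- M) => _ [x Cx <-]; have := fM x Cx; rewrite ler_norml => /andP[].
have fC0 : f @` C !=set0 by have [x Cx] := C0; exists (f x); exists x.
pose s := sup (f @` C); pose i := inf (f @` C).
have fs x : C x -> f x <= s by move=> Cx; apply: ub_le_sup => //; exists x.
have fi x : C x -> i <= f x by move=> Cx; apply: ge_inf => //; exists x.
have [g [cg fg gi gs]] : exists g : X -> R, [/\ continuous g,
    forall x, C x -> f x = g x, forall x, i <= g x & forall x, g x <= s].
  have [si|is_] := leP s i.
    exists (cst i); split=> // [x|x Cx|x]; first exact: cst_continuous.
      by apply/eqP; rewrite eq_le fi//= (le_trans (fs x Cx)).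
    by have [y Cy] := C0; rewrite (le_trans (fi y Cy))// fs.
  pose a := (s + i) / 2; pose b := (s - i) / 2.
  have b0 : 0 < b by rewrite divr_gt0// subr_gt0.
  have cfa : {within C, continuous (fun x => f x - a : R^o)}.
    move=> x; apply: (@continuousB _ R^o (subspace C) f (cst a)).
      exact: cf.
    exact: cst_continuous.
  have fb x : C x -> `|f x - a| <= b.
    move=> Cx; have := fi x Cx; have := fs x Cx.
    by rewrite ler_norml /a /b => h1 h2; apply/andP; split; lra.
  have [g [fg cg gb]] := continuous_bounded_extension normalX cC b0 cfa fb.
  exists (fun x => g x + a); split.
  - move=> x; apply: (@continuousD _ R^o X g (cst a)); first exact: cg.
    exact: cst_continuous.
  - by move=> x Cx; rewrite -fg ?inE// subrK.
  - by move=> x; have := gb x; rewrite ler_norml /a /b => /andP[]; lra.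
  - by move=> x; have := gb x; rewrite ler_norml /a /b => /andP[]; lra.
have fgC : (EFin \o g) @` C = EFin @` (f @` C).
  rewrite image_comp; apply/seteqP; split=> _ [x Cx <-]; exists x => //=;
    by rewrite fg.
have sub : (EFin \o g) @` C `<=` range (EFin \o g).
  by move=> _ [x Cx <-]; exists x.
exists g; split => //; apply/eqP; rewrite eq_le.
- rewrite (ereal_inf_le_tmp sub)/= fgC ereal_inf_EFin//.
  by apply: le_ereal_inf_tmp => _ [x _ <-]; rewrite lee_fin; exact: gi.
- rewrite (ereal_sup_le sub) fgC ereal_sup_EFin// andbT.
  by apply: ge_ereal_sup => _ [x _ <-]; rewrite lee_fin; exact: gs.
Qed.

End TietzeExtremes.

(** * The Tonelli integral of a bounded function *)

Section BoundedIntegral.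
Variables (R : realType) (n : nat).
Hypothesis n_gt0 : (0 < n)%N.
Variables (r : R) (f : 'rV[R]_n -> option R) (g : borel_rV R n -> R) (M : R).
Hypotheses (r_gt0 : 0 < r) (f_qc : quasicontinuous r%:E f)
  (fM : forall x v, f x = Some v -> `|v| <= M)
  (g_meas : measurable_fun setT g) (gM : forall x, `|g x| <= M)
  (fg : (lebesgue_rV R n).-negligible
    [set x | disk r%:E x /\ f x <> Some (g x)]).

Local Notation mu := (lebesgue_rV R n).

Let disk_integral : R := fine (\int[mu]_x (\1_(disk r%:E) x * g x)%:E)%E.

Lemma integrable_disk_indic (u : borel_rV R n -> R) :
  measurable_fun setT u -> (forall x, `|u x| <= M) ->
  mu.-integrable setT (fun x => (\1_(disk r%:E) x * u x)%:E).
Proof.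
move=> mu_ uM.
have mdisk : measurable (disk r%:E : set (borel_rV R n)).
  exact: measurable_disk.
rewrite (_ : (fun _ => _) = (EFin \o u) \_ (disk r%:E)); last first.
  apply/funext => x; rewrite patchE indicE.
  by case: ifPn => _; rewrite ?mul1r// mul0r.
apply: (iffLR (integrable_mkcond _ mdisk)).
apply: measurable_bounded_integrable => //.
- exact: lebesgue_disk_lty.
- exact: measurable_funTS.
- exists M; split; first exact: num_real.
  by move=> y My x _; apply: le_trans (uM x) (ltW My).
Qed.

(** Both integrands are bounded by M and agree almost everywhere off D. *)
Lemma riemann_integral_approx_error (e : R) (D : multirectangle R n)
    (G : 'rV[R]_n -> R) :
  (mrect_L D < e%:E)%E -> continuous G -> (forall x, `|G x| <= M) ->
  (forall x, (disk r%:E `\` mrect_set D) x -> f x = Some (G x)) ->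
  `|riemann_integral r G - disk_integral| <= (M + M) * e.
Proof.
move=> De cG GM fG.
have M0 : 0 <= M by apply: le_trans (gM 0); exact: normr_ge0.
rewrite (riemann_integral_lebesgue n_gt0 r_gt0 cG GM) /disk_integral.
have mG := continuous_measurable_rV cG.
have iG := integrable_disk_indic mG GM.
have ig := integrable_disk_indic g_meas gM.
have mD : measurable (mrect_set D : set (borel_rV R n)).
  exact: measurable_mrect_set.
rewrite -fineB ?integrable_fin_num//.
rewrite -integralB//.
have iB := integrableB measurableT iG ig.
rewrite -lee_fin -abse_EFin fineK; last exact: integrable_fin_num.
apply: (@le_trans _ _ (\int[mu]_x ((M + M) * \1_(mrect_set D) x)%:E)%E).
  apply: le_trans (le_abse_integral _ _ _) _ => //.
    by case/integrableP: iB.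
  apply: ae_ge0_le_integral => //.
  - apply: measurableT_comp => //.
    by case/integrableP: iB.
  - by move=> x _; rewrite lee_fin mulr_ge0// addr_ge0.
  - apply/measurable_EFinP/measurable_funM => //; exact: measurable_indic.
  apply: negligibleS fg => x /= nx.
  apply: contrapT => fgx; apply: nx => _.
  rewrite /= lee_fin -mulrBr normrM.
  have [xd|xd] := pselect (disk r%:E x); last first.
    by rewrite indicE memNset// normr0 mul0r mulr_ge0// addr_ge0.
  rewrite [\1_(disk _) x]indicE mem_set// normr1 mul1r.
  have [xD|xD] := pselect (mrect_set D x).
    rewrite indicE mem_set// mulr1 (le_trans (ler_normB _ _))//.
    by rewrite lerD.
  rewrite [\1_(mrect_set D) x]indicE memNset// mulr0.
  have fGx := fG x (conj xd xD).
  have gGx : g x = G x.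
    apply: contrapT => ne; apply: fgx; split=> //; rewrite fGx => -[E].
    by apply: ne.
  by rewrite gGx subrr normr0.
rewrite (_ : (fun _ => _) =
  fun x => ((M + M)%:E * (\1_(mrect_set D) x)%:E)%E)//.
rewrite ge0_integralZl//; last 2 first.
- exact/measurable_EFinP/measurable_indic.
- by rewrite lee_fin addr_ge0.
rewrite integral_indic// setIT EFinM lee_wpmul2l ?lee_fin ?addr_ge0//.
by rewrite (le_trans (lebesgue_mrect_le D))// ltW.
Qed.

(** G j has the extreme values of f on a subset of the disk, hence its bound. *)
Lemma tonelli_approx_bound (e : nat -> R) D G : tonelli_approx r f e D G ->
  forall j x, `|G j x| <= M.
Proof.
move=> [_ [_ H]] j x; have [_ _ fG Ginf Gsup] := H j.
rewrite ler_norml; apply/andP; split; rewrite -lee_fin.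
  apply: (@le_trans _ _ (ereal_inf (range (EFin \o G j)))); last first.
    by apply: ereal_inf_lbound; exists x.
  rewrite Ginf; apply: le_ereal_inf_tmp => _ [y Sy <-].
  by rewrite lee_fin; have := fM (fG y Sy); rewrite ler_norml => /andP[].
apply: (@le_trans _ _ (ereal_sup (range (EFin \o G j)))).
  by apply: ereal_sup_ubound; exists x.
rewrite Gsup; apply: ge_ereal_sup => _ [y Sy <-].
by rewrite lee_fin; have := fM (fG y Sy); rewrite ler_norml => /andP[].
Qed.

Lemma tonelli_approx_cvg (e : nat -> R) D G : tonelli_approx r f e D G ->
  riemann_integral r (G j) @[j --> \oo] --> disk_integral.
Proof.
move=> H; have GM := tonelli_approx_bound H; have [_ [e0 {}H]] := H.
have bound j : `|riemann_integral r (G j) - disk_integral| <= (M + M) * e j.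
  have [[De _ _ _] cG fG _ _] := H j.
  exact: riemann_integral_approx_error De cG (GM j) fG.
apply/cvgrPdist_le => eps eps0.
have : (M + M) * e j @[j --> \oo] --> (0 : R).
  by rewrite -(mulr0 (M + M)); apply: cvgM => //; exact: cvg_cst.
move/cvgrPdist_le => /(_ eps eps0); apply: filterS => j.
rewrite sub0r normrN => h; rewrite distrC.
by apply: le_trans (bound j) (le_trans (ler_norm _) h).
Qed.

(** Choosing e j <= c, the measure of the disk, keeps the multirectangle from
    covering the disk, so there is a point from which to extend f. *)
Lemma tonelli_approx_exists : exists e D G, tonelli_approx r f e D G.
Proof.
pose c : R := fine (mu (disk r%:E)).
have cE : c%:E = mu (disk r%:E).
  by rewrite fineK// ge0_fin_numE//; exact: lebesgue_disk_lty.
have c0 : 0 < c by rewrite -lte_fin cE; exact: lebesgue_disk_gt0.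
pose e j : R := c * j.+1%:R^-1.
have e0 j : 0 < e j by rewrite mulr_gt0.
have ec j : e j <= c.
  by rewrite /e ler_piMr ?(ltW c0)// invf_le1 ?ler1n.
have [D HD] := choice (fun j => f_qc (e0 j)).
have HG j : exists G : 'rV[R]_n -> R,
    let S := disk r%:E `\` mrect_set (D j) in
    [/\ continuous G, forall x, S x -> f x = Some (G x),
        ereal_inf (range (EFin \o G)) = ereal_inf ((EFin \o G) @` S) &
        ereal_sup (range (EFin \o G)) = ereal_sup ((EFin \o G) @` S)].
  have [De oD fdef cf] := HD j; set S := disk r%:E `\` _ in fdef cf *.
  have cS : closed S.
    by apply: closedI; [exact: disk_closed|exact: open_closedC].
  have S0 : S !=set0.
    apply/set0P/negP => /eqP; rewrite /S setD_eq0 => sub.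
    have : (mu (disk r%:E) < mu (disk r%:E))%E.
      apply: (@le_lt_trans _ _ (mu (mrect_set (D j)))).
        apply: le_measure; rewrite ?inE//; first exact: measurable_disk.
        exact: measurable_mrect_set.
      rewrite (le_lt_trans (lebesgue_mrect_le _))// (lt_le_trans De)//.
      by rewrite -cE lee_fin.
    by rewrite ltxx.
  have fS x : S x -> f x = Some (odflt 0 (f x)).
    by move=> Sx; have := fdef x Sx => /=; case: (f x).
  have [G [cG fG Gi Gs]] := continuous_extension_same_extremes
    (@pseudometric_normal R 'rV[R]_n) cS S0 cf (fun x Sx => fM (fS x Sx)).
  by exists G; split=> // x Sx; rewrite fS// -fG.
have [G HG'] := choice HG.
exists e, D, G; split=> //; split.
  rewrite -(mulr0 c); apply: cvgM; first exact: cvg_cst.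
  exact: cvg_harmonic.
by move=> j /=; have [cG fG Gi Gs] := HG' j; split.
Qed.

(** All admissible limits coincide, so the choice made by [bounded_integral]
    does not matter. *)
Lemma bounded_integral_lebesgue : bounded_integral r f = disk_integral.
Proof.
have [e [D [G H]]] := tonelli_approx_exists.
pose V : set R := [set v | exists e D g, tonelli_approx r f e D g /\
  (fun j => riemann_integral r (g j)) @ \oo --> v].
have [e' [D' [G' [H']]]] : V (bounded_integral r f).
  apply: (@getPex _ V); exists disk_integral, e, D, G.
  by split=> //; exact: tonelli_approx_cvg H.
move=> /cvg_lim <-//.
by have /cvg_lim -> := tonelli_approx_cvg H'.
Qed.

End BoundedIntegral.

(** * The Tonelli integral of a nonnegative function *)

Lemma min_cst_continuous (R : realType) (f : R -> R) (c : R) :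
  continuous f -> continuous (fun x => Num.min (f x) c).
Proof.
move=> cf x; apply: (@continuous_min R R f (cst c)); first exact: cf.
exact: cst_continuous.
Qed.

Lemma max_cst_continuous (R : realType) (f : R -> R) (c : R) :
  continuous f -> continuous (fun x => Num.max (f x) c).
Proof.
move=> cf x; apply: (@continuous_max R R f (cst c)); first exact: cf.
exact: cst_continuous.
Qed.

Section TonelliIntegral.
Variables (R : realType) (n : nat).
Hypothesis n_gt0 : (0 < n)%N.
Variables (f : 'rV[R]_n -> option R) (g : borel_rV R n -> R).
Hypotheses (f_qc : quasicontinuous +oo%E f)
  (f_ge0 : forall x v, f x = Some v -> 0 <= v)
  (g_meas : measurable_fun setT g) (g_ge0 : forall x, 0 <= g x)
  (fg : (lebesgue_rV R n).-negligible [set x | f x <> Some (g x)]).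

Local Notation mu := (lebesgue_rV R n).

Lemma quasicontinuous_omap (phi : R -> R) (r : R) :
  continuous phi -> phi 0 = 0 -> quasicontinuous r%:E (omap phi \o f).
Proof.
move=> cphi phi0 e e0; have [D [De oD fdef cf]] := f_qc e0.
have sub : disk r%:E `\` mrect_set D `<=` disk +oo%E `\` mrect_set D.
  by move=> x [_ xD]; split=> //; rewrite /disk/= leey.
exists D; split=> //.
  by move=> x /sub/fdef /=; case: (f x).
rewrite (_ : _ \o _ = phi \o (odflt 0 \o f)); last first.
  by apply/funext => x /=; case: (f x).
apply: (continuous_subspaceW sub) => x.
apply: (@continuous_comp (subspace (disk +oo%E `\` mrect_set D)) _ _
  (odflt 0 \o f) phi); first exact: cf.
exact: cphi.
Qed.

Lemma bounded_integral_omap (phi : R -> R) (r M : R) : 0 < r ->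
  continuous phi -> phi 0 = 0 -> (forall v, 0 <= v -> `|phi v| <= M) ->
  bounded_integral r (omap phi \o f) =
  fine (\int[mu]_x (\1_(disk r%:E) x * phi (g x))%:E)%E.
Proof.
move=> r0 cphi phi0 phiM.
apply: (@bounded_integral_lebesgue _ _ n_gt0 _ _ _ M) => //.
- exact: quasicontinuous_omap.
- by move=> x v /=; case E: (f x) => [w|]//= [<-]; apply/phiM/f_ge0/E.
- by apply: measurableT_comp => //; exact: continuous_measurable_fun.
- by move=> x; exact: phiM.
- apply: negligibleS fg => x /= [_]; apply: contra_not => ->//.
Qed.

Definition truncated_integral (q : R * R) : \bar R :=
  (\int[mu]_x (\1_(disk q.1%:E) x * Num.min (Num.max (g x) 0) q.2)%:E)%E.

Let trunc_fun (q : R * R) (x : borel_rV R n) : R :=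
  \1_(disk q.1%:E) x * Num.min (Num.max (g x) 0) q.2.

Let measurable_trunc_fun q : measurable_fun setT (fun x => (trunc_fun q x)%:E).
Proof.
apply/measurable_EFinP/measurable_funM.
  by apply: measurable_indic; exact: measurable_disk.
by apply: measurable_minr => //; exact: measurable_maxr.
Qed.

Let trunc_fun_ge0 q x : 0 <= q.2 -> (0 <= (trunc_fun q x)%:E)%E.
Proof.
by move=> q0; rewrite lee_fin mulr_ge0// le_min q0 le_max lexx orbT.
Qed.

Let trunc_fun_le q q' x : 0 <= q.2 -> q.1 <= q'.1 -> q.2 <= q'.2 ->
  ((trunc_fun q x)%:E <= (trunc_fun q' x)%:E)%E.
Proof.
move=> q0 h1 h2; rewrite lee_fin /trunc_fun; apply: ler_pM => //.
- by rewrite le_min q0 le_max lexx orbT.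
- rewrite !indicE; case: (boolP (x \in disk q.1%:E)) => [|_]; last by [].
  rewrite inE => xd; rewrite mem_set//.
  by move: xd; rewrite /disk/= !lee_fin => /le_trans; apply.
- by rewrite le_min ge_min lexx/= ge_min h2 orbT.
Qed.

Lemma truncated_integral_fin q : 0 <= q.2 -> truncated_integral q \is a fin_num.
Proof.
move=> q0; apply: integrable_fin_num => //.
apply: (integrable_disk_indic (M := q.2) q.1).
  by apply: measurable_minr => //; exact: measurable_maxr.
move=> x; rewrite ger0_norm; first by rewrite ge_min lexx orbT.
by rewrite le_min q0 le_max lexx orbT.
Qed.

(** The truncated integral increases in both parameters and is squeezed between
    its values at equal integer parameters k, to which monotone convergence
    applies, and the integral of g. *)
Lemma truncated_integral_cvg :
  truncated_integral q @[q --> filter_prod (pinfty_nbhs R) (pinfty_nbhs R)]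
    --> (\int[mu]_x (g x)%:E)%E.
Proof.
pose u k := truncated_integral (k%:R, k%:R).
have cvg_u : u k @[k --> \oo] --> (\int[mu]_x (g x)%:E)%E.
  have -> : (\int[mu]_x (g x)%:E =
      \int[mu]_x limn (fun k => (trunc_fun (k%:R, k%:R) x)%:E))%E.
    apply: eq_integral => x _; apply/esym/cvg_lim => //.
    apply: cvg_near_cst.
    have big_k : \forall k \near \oo,
        eucl_norm (x : 'rV[R]_n) <= k%:R /\ g x <= k%:R.
      by near=> k; split; near: k; exact: nbhs_infty_ger.
    apply: filterS big_k => k [xk gk].
    rewrite /trunc_fun/= indicE mem_set ?mul1r; last by rewrite /disk/= lee_fin.
    by rewrite max_l// min_l.
  apply: cvg_monotone_convergence => //.
  - by move=> k; exact: measurable_trunc_fun.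
  - by move=> k x _; exact: trunc_fun_ge0.
  - by move=> x _ j k jk; apply: trunc_fun_le => //=; rewrite ler_nat.
pose k_of (q : R * R) : nat := Num.truncn (Num.min q.1 q.2).
have near_ge (k : R) : \forall q \near
    filter_prod (pinfty_nbhs R) (pinfty_nbhs R), k <= q.1 /\ k <= q.2.
  exists ([set s | k <= s], [set s | k <= s]) => /=.
    by split; apply: nbhs_pinfty_ge; exact: num_real.
  by move=> q /=.
have cvg_k : k_of @ filter_prod (pinfty_nbhs R) (pinfty_nbhs R) --> \oo.
  move=> A [k _ kA]; apply: filterS (near_ge k%:R) => q [q1 q2].
  have qk : k%:R <= Num.min q.1 q.2 by rewrite le_min q1.
  by apply: kA; rewrite /= truncn_ge_nat// (le_trans _ qk).
apply: (@squeeze_cvge _ _ _ _ (u \o k_of) _ (cst (\int[mu]_x (g x)%:E)%E)).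
- apply: filterS (near_ge 0) => q [q1 q2].
  have qm : 0 <= Num.min q.1 q.2 by rewrite le_min q1.
  have : (k_of q)%:R <= Num.min q.1 q.2 by rewrite truncn_le.
  rewrite le_min => /andP[k1 k2]; apply/andP; split.
    apply: ge0_le_integral => //.
    - by move=> x _; exact: trunc_fun_ge0.
    - exact: measurable_trunc_fun.
    - exact: measurable_trunc_fun.
    - by move=> x _; exact: trunc_fun_le.
  apply: ge0_le_integral => //.
  - by move=> x _; exact: trunc_fun_ge0.
  - exact: measurable_trunc_fun.
  - exact/measurable_EFinP.
  move=> x _; rewrite lee_fin /trunc_fun max_l// indicE.
  by case: (_ \in _); rewrite ?mul0r// mul1r ge_min lexx.
- exact: cvg_comp cvg_k cvg_u.
- exact: cvg_cst.
Unshelve. all: by end_near. Qed.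

Let near_pos : \forall q \near filter_prod (pinfty_nbhs R) (pinfty_nbhs R),
  0 < q.1 /\ 0 < q.2.
Proof.
exists ([set s | 0 < s], [set s | 0 < s]) => /=.
  by split; apply: nbhs_pinfty_gt; exact: num_real.
by move=> q /=.
Qed.

Lemma tonelli_pos_lebesgue : tonelli_pos f = (\int[mu]_x (g x)%:E)%E.
Proof.
apply: cvg_lim => //; apply: cvg_trans truncated_integral_cvg.
apply: near_eq_cvg; apply: filterS near_pos => q [q1 q2].
rewrite (bounded_integral_omap (M := q.2) q1).
- by rewrite fineK//; apply: truncated_integral_fin; exact: ltW.
- by apply/min_cst_continuous/max_cst_continuous => x; exact: cvg_id.
- by rewrite maxxx min_l// ltW.
- move=> v v0; rewrite ger0_norm; first by rewrite ge_min lexx orbT.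
  by rewrite le_min le_max v0 (ltW q2).
Qed.

Lemma tonelli_neg_ge0 : tonelli_neg f = 0%E.
Proof.
apply: cvg_lim => //; apply: cvg_trans (cvg_cst (0%E : \bar R)).
apply: near_eq_cvg; apply: filterS near_pos => q [q1 q2].
have neg0 v : 0 <= v -> Num.max (Num.min v 0) (- q.2) = 0.
  by move=> v0; rewrite min_r// max_l// oppr_le0 ltW.
rewrite (bounded_integral_omap (M := 0) q1).
- rewrite integral0_eq// => x _; by rewrite neg0// mulr0.
- by apply/max_cst_continuous/min_cst_continuous => x; exact: cvg_id.
- exact: neg0.
- by move=> v v0; rewrite neg0// normr0.
exact: filter_filter.
Qed.

End TonelliIntegral.

(** * Slicing along the first coordinate *)

Section Fubini.
Variable R : realType.

Lemma lebesgue_rV1_integral (h : borel_rV R 1 -> \bar R) :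
  measurable_fun setT h -> (forall x, 0 <= h x)%E ->
  (\int[lebesgue_rV R 1]_x h x = \int[lebesgue_measure]_t h (const_mx t))%E.
Proof.
move=> mh h0; rewrite (@lebesgue_rV_fubini R 0 h mh h0).
apply: eq_integral => t _ /=.
have mht : measurable_fun setT (fun y : borel_rV R 0 => h (cons_rV (t, y))).
  apply: measurableT_comp mh _; apply: measurableT_comp.
    exact: measurable_cons_rV.
  exact: measurable_pair1.
rewrite integral_dirac// diracT mul1e; congr h.
apply/rowP => i; case: (split_ordP (i : 'I_(1 + 0))) => [j ->|[]//].
by rewrite cons_rVl mxE.
Qed.

Variable d : nat.

Lemma measurable_row_mx (x : borel_rV R 1) :
  measurable_fun setT (fun y : borel_rV R d => row_mx x y : borel_rV R (1 + d)).
Proof.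
rewrite (_ : (fun _ => _) = @cons_rV R d \o pair ((x : 'rV[R]_1) 0 0)).
  exact: (measurableT_comp (@measurable_cons_rV R d) (pair1_measurable _)).
apply/funext => y; rewrite /cons_rV/=; congr row_mx.
by apply/rowP => i; rewrite (ord1 i) mxE.
Qed.

Variable h : borel_rV R (1 + d) -> \bar R.
Hypotheses (mh : measurable_fun [set: borel_rV R (1 + d)] h)
  (h0 : forall z, (0 <= h z)%E).

Lemma measurable_partial_lebesgue :
  measurable_fun setT (fun x : borel_rV R 1 =>
    (\int[lebesgue_rV R d]_y h (row_mx x y))%E).
Proof.
pose hc := h \o (@cons_rV R d : R * borel_rV R d -> borel_rV R (1 + d)).
have mhc : measurable_fun setT hc.
  by apply: measurableT_comp => //; exact: measurable_cons_rV.
have mF := measurable_fun_fubini_tonelli_F (m2 := lebesgue_rV R d) _ mhc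
  (fun p => h0 (cons_rV p)).
rewrite (_ : (fun _ => _) = fubini_F (lebesgue_rV R d) hc \o
    (fun x : borel_rV R 1 => x 0 0)).
  by apply: measurableT_comp => //; exact: measurable_coord.
apply/funext => x; rewrite /fubini_F/hc/=; apply: eq_integral => y _.
congr h; rewrite /cons_rV/=; congr row_mx.
by apply/rowP => i; rewrite (ord1 i) mxE.
Qed.

Lemma fubini_row_mx :
  (\int[lebesgue_rV R (1 + d)]_z h z =
   \int[lebesgue_rV R 1]_x \int[lebesgue_rV R d]_y h (row_mx x y))%E.
Proof.
rewrite lebesgue_rV_fubini// lebesgue_rV1_integral//.
- exact: measurable_partial_lebesgue.
- by move=> x; apply: integral_ge0.
Qed.

End Fubini.

Section NullSections.
Variables (R : realType) (d : nat).

(** The measures of the sections of a null set integrate to 0. *)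
Lemma negligible_sections (N : set (borel_rV R (1 + d))) :
  (lebesgue_rV R (1 + d)).-negligible N ->
  (lebesgue_rV R 1).-negligible [set x | ~
    (lebesgue_rV R d).-negligible [set y | N (row_mx x y)]].
Proof.
move=> [N' [mN' N'0 NN']].
pose h (z : borel_rV R (1 + d)) : \bar R := (\1_N' z)%:E.
have mh : measurable_fun [set: borel_rV R (1 + d)] h.
  by apply/measurable_EFinP; exact: measurable_indic.
have h0 z : (0 <= h z)%E by rewrite lee_fin.
have msec x : measurable [set y : borel_rV R d | N' (row_mx x y)].
  by rewrite -[X in measurable X]setTI; exact: measurable_row_mx.
have hx x : (\int[lebesgue_rV R d]_y h (row_mx x y))%E =
    lebesgue_rV R d [set y | N' (row_mx x y)].
  rewrite /h -[in RHS](setIT [set y | _]) -integral_indic//.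
have := fubini_row_mx mh h0.
rewrite integral_indic// setIT [X in X = _]N'0 => /esym int0.
have mp := measurable_partial_lebesgue mh h0.
have [Z [mZ Z0 ZP]] : ae_eq (lebesgue_rV R 1) setT
    (fun x => \int[lebesgue_rV R d]_y h (row_mx x y))%E (cst 0%E).
  apply/(ae_eq_integral_abs _ measurableT mp).
  rewrite -[RHS]int0; apply: eq_integral => x _.
  by rewrite gee0_abs//; exact: integral_ge0.
exists Z; split => // x nx; apply: ZP => /= hx0; apply: nx.
exists [set y | N' (row_mx x y)]; split=> //; last by move=> y /NN'.
by rewrite -[LHS]hx; exact: hx0.
Qed.

End NullSections.

(** * The reduction formula *)

Section NonnegativeTonelli.
Variables (R : realType) (n : nat).
Hypothesis n_gt0 : (0 < n)%N.
Variable f : 'rV[R]_n -> option R.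
Hypotheses (f_qc : quasicontinuous +oo%E f)
  (f_ge0 : forall x v, f x = Some v -> 0 <= v).

Lemma tonelli_integral_lebesgue (g : borel_rV R n -> R) :
  measurable_fun setT g -> (forall x, 0 <= g x) ->
  (lebesgue_rV R n).-negligible [set x | f x <> Some (g x)] ->
  tonelli_integral f = (\int[lebesgue_rV R n]_x (g x)%:E)%E.
Proof.
move=> mg g0 fg; rewrite /tonelli_integral.
rewrite (tonelli_neg_ge0 n_gt0 f_qc f_ge0 mg g0 fg) adde0.
exact: tonelli_pos_lebesgue.
Qed.

(** The representative takes only the value 0 and values of f. *)
Lemma nonneg_representative : exists g : borel_rV R n -> R,
  [/\ measurable_fun setT g, forall x, 0 <= g x
    & (lebesgue_rV R n).-negligible [set x | f x <> Some (g x)]].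
Proof.
have [g [mg fg g0]] := quasicontinuous_representative f_qc.
by exists g; split=> // x; have [->//|/f_ge0] := g0 x.
Qed.

Lemma tonelli_integral_ge0 : (0 <= tonelli_integral f)%E.
Proof.
have [g [mg g0 fg]] := nonneg_representative.
rewrite (tonelli_integral_lebesgue mg g0 fg).
by apply: integral_ge0 => x _; rewrite lee_fin.
Qed.

Lemma tonelli_summable_fin :
  tonelli_integral f \is a fin_num -> tonelli_summable f.
Proof.
move=> ffin; have [g [mg g0 fg]] := nonneg_representative.
split=> //; split=> //; right.
by rewrite (tonelli_neg_ge0 n_gt0 f_qc f_ge0 mg g0 fg).
Qed.

End NonnegativeTonelli.

Section Sections.
Variables (R : realType) (d : nat) (A : set 'rV[R]_1) (B : set 'rV[R]_d).
Variable f : 'rV[R]_(1 + d) -> option R.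

Lemma prod_set_row_mx x y : prod_set A B (row_mx x y) <-> A x /\ B y.
Proof. by rewrite /prod_set/= row_mxKl row_mxKr. Qed.

Lemma extend0_row_mx_in x y : A x ->
  extend0 (prod_set A B) f (row_mx x y) = extend0 B (section_at f x) y.
Proof.
move=> Ax; rewrite /extend0 /section_at; congr (if _ then _ else _).
by apply/idP/idP; rewrite !inE => /=; rewrite prod_set_row_mx; tauto.
Qed.

Lemma extend0_row_mx_out x y : ~ A x ->
  extend0 (prod_set A B) f (row_mx x y) = Some 0.
Proof.
by move=> Ax; rewrite /extend0 memNset// prod_set_row_mx => -[].
Qed.

End Sections.

Theorem theorem168 (R : realType) (d : nat) (d_gt0 : (0 < d)%N)
    (a b : \bar R) (lo hi : 'I_d -> \bar R)
    (f : 'rV[R]_(1 + d) -> option R)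
    (f_qc : quasicontinuous_on (prod_set (open_itv1 a b) (open_rect lo hi)) f)
    (f_ge0 : forall z v, prod_set (open_itv1 a b) (open_rect lo hi) z ->
       f z = Some v -> 0 <= v)
    (f_sections : tonelli_null [set x | open_itv1 a b x /\
       ~ summable_on (open_rect lo hi) (section_at f x)])
    (F_summable : summable_on (open_itv1 a b)
       (partial_integral (open_rect lo hi) f)) :
  summable_on (prod_set (open_itv1 a b) (open_rect lo hi)) f /\
  integral_on (prod_set (open_itv1 a b) (open_rect lo hi)) f =
    integral_on (open_itv1 a b) (partial_integral (open_rect lo hi) f).
Proof.
move: f_qc f_ge0 f_sections F_summable.
set A := open_itv1 a b; set B := open_rect lo hi => f_qc f_ge0 f_sec F_sum.
pose f0 := extend0 (prod_set A B) f.
have f0_ge0 z v : f0 z = Some v -> 0 <= v.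
  rewrite /f0 /extend0; case: ifPn => [/set_mem Pz|_ [<-]//].
  exact: f_ge0.
have sec_ge0 x y v : A x -> extend0 B (section_at f x) y = Some v -> 0 <= v.
  by move=> Ax; rewrite -(extend0_row_mx_in B f y Ax); exact: f0_ge0.
have [g [mg g0 fg]] := nonneg_representative f_qc f0_ge0.
pose I (x : borel_rV R 1) : \bar R :=
  (\int[lebesgue_rV R d]_y (g (row_mx x y))%:E)%E.
have I_ge0 x : (0 <= I x)%E by apply: integral_ge0 => y _; rewrite lee_fin.
have mgE : measurable_fun [set: borel_rV R (1 + d)] (fun z => (g z)%:E).
  exact/measurable_EFinP.
have mI : measurable_fun setT I.
  apply: (@measurable_partial_lebesgue _ _ (fun z => (g z)%:E)) => //.
pose G x := fine (I x).
have mG : measurable_fun setT G by exact: measurableT_comp.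
have G_ge0 x : 0 <= G x by exact: fine_ge0.
pose F0 := extend0 A (partial_integral B f).
have F0_qc : quasicontinuous +oo%E F0 by have [[]] := F_sum.
have F0_ge0 x v : F0 x = Some v -> 0 <= v.
  rewrite /F0 /extend0; case: ifPn => [/set_mem Ax|_ [<-]//].
  rewrite /partial_integral; case: asboolP => // -[[sqc _] _] [<-].
  by apply/fine_ge0/tonelli_integral_ge0 => // y v'; exact: sec_ge0.
have good x : (lebesgue_rV R d).-negligible
      [set y | f0 (row_mx x y) <> Some (g (row_mx x y))] ->
    ~ (A x /\ ~ summable_on B (section_at f x)) ->
    I x \is a fin_num /\ F0 x = Some (G x).
  move=> nx sx; rewrite /F0 /extend0.
  have mgx : measurable_fun setT (fun y : borel_rV R d => g (row_mx x y)).
    exact: (measurableT_comp mg (measurable_row_mx x)).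
  case: ifPn => [/set_mem Ax|/negP Ax].
    have sumx : summable_on B (section_at f x).
      by apply: contrapT => ns; apply: sx.
    have [[sqc _] sfin] := sumx.
    have sI : tonelli_integral (extend0 B (section_at f x)) = I x.
      apply: tonelli_integral_lebesgue => //.
        by move=> y v; exact: sec_ge0.
      apply: negligibleS nx => y /=.
      by rewrite /f0 extend0_row_mx_in.
    split; first by rewrite -sI.
    rewrite /partial_integral asboolT// /integral_on sI//.
  have Ax' : ~ A x by move=> ?; apply: Ax; rewrite inE.
  (* For x outside (a, b) the section of the extension is 0 everywhere. *)
  have I0 : I x = 0%E.
    rewrite -(integral0 (lebesgue_rV R d) setT).
    apply: ge0_ae_eq_integral => //.
    - exact/measurable_EFinP.
    - by move=> y _; rewrite lee_fin.
    apply: negligibleS nx => y /= ny; rewrite /f0 extend0_row_mx_out//.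
    by move=> [E]; apply: ny => _; rewrite -E.
  by rewrite /G I0.
(* Off this negligible set of x, by [good], the integral I x is finite and the
   inner integral of the theorem, extended by 0, has the value fine (I x). *)
pose bad : set (borel_rV R 1) := [set x | ~ (lebesgue_rV R d).-negligible
    [set y | f0 (row_mx x y) <> Some (g (row_mx x y))]] `|`
  [set x | A x /\ ~ summable_on B (section_at f x)].
have bad0 : (lebesgue_rV R 1).-negligible bad.
  apply: negligibleU; last exact: tonelli_null_negligible.
  exact: negligible_sections fg.
have goodP x : ~ bad x -> I x \is a fin_num /\ F0 x = Some (G x).
  move=> /not_orP[/contrapT h1 h2]; exact: good.
have F0_int : tonelli_integral F0 = (\int[lebesgue_rV R 1]_x (G x)%:E)%E.
  apply: tonelli_integral_lebesgue => //.
  apply: negligibleS bad0 => x /= Fx; apply: contrapT => /goodP[_ E].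
  exact: Fx.
have f0_int : tonelli_integral f0 = (\int[lebesgue_rV R (1 + d)]_z (g z)%:E)%E.
  exact: tonelli_integral_lebesgue.
have E : tonelli_integral f0 = tonelli_integral F0.
  rewrite f0_int F0_int fubini_row_mx//.
  apply: ge0_ae_eq_integral => //.
  - exact/measurable_EFinP.
  - by move=> x _; exact: I_ge0.
  - by move=> x _; rewrite lee_fin; exact: G_ge0.
  apply: negligibleS bad0 => x /= nx; apply: contrapT => /goodP[Ifin _].
  by apply: nx => _; rewrite /G fineK.
split; last exact: E.
apply: tonelli_summable_fin => //.
by rewrite -/f0 E; have [] := F_sum.
Qed.
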